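(* Suppose the hypotheses of the convergence theorem: $x_0\in\mathbb{R}^n$ deterministic, $\{S_k\}$ i.i.d. random matrices in $\mathbb{R}^{n\times p}$ satisfying the JL property with constants $C,\omega$, and $p>\frac{\log 2}{C}\max\{\omega^2,1/\delta^2\}$ for some $\delta\in(0,1)$. Let $\lambda\in\mathbb{N}$ and $k\ge\lambda-1$. Then for all $t$ with $|t|\le1/\omega$, $$\mathbb{E}\Big[\exp\{t(\tilde\rho_k^\lambda-\rho_k^\lambda)\}\,\Big|\,\mathcal{F}_{k-\lambda+1}\Big]\le\exp\Big\{\frac{t^2M_{k-\lambda+1}^4}{2Cp\lambda}\sum_{j=1}^\lambda\frac1j\Big\}\le\exp\Big\{t^2\,\frac{M_{k-\lambda+1}^4(1+\log\lambda)}{2Cp\lambda}\Big\},$$ i.e. conditionally on $\mathcal{F}_{k-\lambda+1}$, $\tilde\rho_k^\lambda-\rho_k^\lambda\sim\mathbf{SE}\big(\frac{M_{k-\lambda+1}^4(1+\log\lambda)}{2Cp\lambda},\omega\big)$.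
   Context: Setting: $A\in\mathbb{R}^{m\times n}$, $b\in\mathbb{R}^m$, $B\in\mathbb{R}^{m\times m}$ symmetric positive definite with symmetric positive definite square root $B^{1/2}$; $\mathcal{P}$ the orthogonal projection onto $\operatorname{col}(B^{1/2}A)$. Iteration: $x_k = x_{k-1} - S_k(S_k^{\top}A^{\top}BAS_k)^{\dagger}S_k^{\top}A^{\top}B(Ax_{k-1}-b)$; $r_k=Ax_k-b$; $g_k=A^\top Br_k$; $\tilde g_k=S_{k+1}^\top g_k$. $\mathcal{F}_j=\sigma(S_1,\dots,S_j)$ ($\mathcal{F}_0$ trivial). Window estimators: $\rho_k^\lambda=\frac1\lambda\sum_{i=k-\lambda+1}^k\|g_i\|_2^2$, $\tilde\rho_k^\lambda=\frac1\lambda\sum_{i=k-\lambda+1}^k\|\tilde g_i\|_2^2$. $M_{k-\lambda+1}=\|A^\top B^{1/2}\|_2\,\|\mathcal{P}B^{1/2}r_{k-\lambda+1}\|_2$. Notation $X\sim\mathbf{SE}(\sigma^2,\omega)$ (conditionally on $\mathcal F$) means $\mathbb{E}[e^{tX}\mid\mathcal F]\le e^{t^2\sigma^2}$ for $|t|\le1/\omega$. JL property: a random matrix $S\in\mathbb{R}^{n\times p}$ satisfies it with constants $C>0,\omega>0$ if for every fixed $z\in\mathbb{R}^n$: $\mathbb{E}\|S^\top z\|_2^2=\|z\|_2^2$; $\mathbb{E}\exp\{t(\|S^\top z\|_2^2-\|z\|_2^2)\}\le \exp\{t^2\|z\|_2^4/(2Cp)\}$ for $|t|\le 1/\omega$;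 and $\mathbb{P}(|\|S^\top z\|_2^2-\|z\|_2^2|>\delta\|z\|_2^2)\le 2e^{-\min\{Cp\delta^2,Cp\delta/\omega\}}$ for $\delta>0$. *)

(* Defs.v *)
From HB Require Import structures.
From mathcomp Require Import all_boot all_order all_algebra.
From mathcomp Require Import all_classical all_reals all_analysis.
From mathcomp Require Export measurable_realfun.
Set Implicit Arguments. Unset Strict Implicit. Unset Printing Implicit Defensive.
Import Order.TTheory GRing.Theory Num.Theory.
Local Open Scope classical_set_scope.
Local Open Scope ring_scope.

Section Defs.
Variable R : realType.

Definition norm2 (k : nat) (v : 'cV[R]_k) : R := Num.sqrt (\sum_i (v i 0) ^+ 2).

Definition opnorm2 (k l : nat) (M : 'M[R]_(k, l)) : R :=
  sup [set norm2 (M *m v) | v in [set v : 'cV[R]_l | norm2 v = 1]].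

Definition sym_pd (k : nat) (M : 'M[R]_k) : Prop :=
  M^T = M /\ forall v : 'cV[R]_k, v != 0 -> 0 < (v^T *m M *m v) 0 0.

Definition penrose (k l : nat) (M : 'M[R]_(k, l)) (X : 'M[R]_(l, k)) : Prop :=
  [/\ M *m X *m M = M, X *m M *m X = X, (M *m X)^T = M *m X & (X *m M)^T = X *m M].
Definition mpinv (k l : nat) (M : 'M[R]_(k, l)) : 'M[R]_(l, k) := xget 0 (penrose M).

Definition is_orth_proj_col (k l : nat) (M : 'M[R]_(k, l)) (Q : 'M[R]_k) : Prop :=
  [/\ Q^T = Q, Q *m Q = Q & (Q^T :=: M^T)%MS].
Definition orth_proj_col (k l : nat) (M : 'M[R]_(k, l)) : 'M[R]_k :=
  xget 0 (is_orth_proj_col M).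

Variables (m n p : nat) (A : 'M[R]_(m, n)) (b : 'cV[R]_m) (B : 'M[R]_m)
  (x0 : 'cV[R]_n).

(* the sketched iteration; S k is the sketch used at step k (k >= 1) *)
Fixpoint iterate (S : nat -> 'M[R]_(n, p)) (k : nat) : 'cV[R]_n :=
  match k with
  | 0 => x0
  | k'.+1 =>
    let Sk := S k'.+1 in let xp := iterate S k' in
    xp - Sk *m mpinv (Sk^T *m A^T *m B *m A *m Sk) *m Sk^T *m A^T *m B
            *m (A *m xp - b)
  end.

Definition resid (S : nat -> 'M[R]_(n, p)) k : 'cV[R]_m := A *m iterate S k - b.
Definition grad (S : nat -> 'M[R]_(n, p)) k : 'cV[R]_n := A^T *m B *m resid S k.
Definition sgrad (S : nat -> 'M[R]_(n, p)) k : 'cV[R]_p := (S k.+1)^T *m grad S k.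

Definition rho (S : nat -> 'M[R]_(n, p)) (lam k : nat) : R :=
  lam%:R^-1 * \sum_(k.+1 - lam <= i < k.+1) norm2 (grad S i) ^+ 2.
Definition rhot (S : nat -> 'M[R]_(n, p)) (lam k : nat) : R :=
  lam%:R^-1 * \sum_(k.+1 - lam <= i < k.+1) norm2 (sgrad S i) ^+ 2.

(* M_j = ||A^T B^{1/2}||_2 ||P B^{1/2} r_j||_2, Bh = B^{1/2} *)
Definition Mconst (Bh : 'M[R]_m) (S : nat -> 'M[R]_(n, p)) (j : nat) : R :=
  opnorm2 (A^T *m Bh) * norm2 (orth_proj_col (Bh *m A) *m Bh *m resid S j).

End Defs.

Section Prob.
Context {R : realType} {d : measure_display} {T : measurableType d}.
Local Open Scope ereal_scope.

Definition mx_meas (k l : nat) : set (set 'M[R]_(k, l)) :=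
  <<s [set E | exists (a : 'I_k) (c : 'I_l) (Y : set R),
        measurable Y /\ E = [set M : 'M[R]_(k, l) | Y (M a c)]] >>.

Definition rand_mx (k l : nat) (X : T -> 'M[R]_(k, l)) : Prop :=
  forall H, mx_meas H -> measurable (X @^-1` H).

Definition sigma_of (k l : nat) (X : T -> 'M[R]_(k, l)) : set (set T) :=
  [set X @^-1` H | H in @mx_meas k l].

Definition filt (k l : nat) (S : nat -> T -> 'M[R]_(k, l)) (j : nat) : set (set T) :=
  <<s \bigcup_(i in [set i : nat | (1 <= i <= j)%N]) sigma_of (S i) >>.

Definition iid (P : probability T R) (k l : nat) (S : nat -> T -> 'M[R]_(k, l)) : Prop :=
  [/\ forall i, rand_mx (S i.+1),
      forall i H, mx_meas H -> P (S i.+1 @^-1` H) = P (S 1%N @^-1` H) &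
      forall (s : seq nat) (E : nat -> set T), uniq s -> all (leq 1) s ->
        (forall i, i \in s -> sigma_of (S i) (E i)) ->
        P (\big[setI/setT]_(i <- s) E i) = \prod_(i <- s) P (E i)].

Definition JL (P : probability T R) (k l : nat) (X : T -> 'M[R]_(k, l)) (C w : R) : Prop :=
  forall z : 'cV[R]_k,
  [/\ \int[P]_x ((norm2 ((X x)^T *m z) ^+ 2)%:E) = (norm2 z ^+ 2)%:E,
      forall t : R, (`|t| <= w^-1)%R ->
        \int[P]_x ((expR (t * (norm2 ((X x)^T *m z) ^+ 2 - norm2 z ^+ 2)))%:E)
        <= (expR (t ^+ 2 * norm2 z ^+ 4 / (2 * C * l%:R)))%:E &
      forall dl : R, (0 < dl)%R ->
        P [set x | (dl * norm2 z ^+ 2 < `|norm2 ((X x)^T *m z) ^+ 2 - norm2 z ^+ 2|)%R]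
        <= (2 * expR (- Num.min (C * l%:R * dl ^+ 2) (C * l%:R * dl / w)))%:E].

(* Y is a version of the conditional expectation of the nonnegative X given
   the sigma-algebra G *)
Definition is_cond_exp (P : probability T R) (G : set (set T)) (X : T -> R)
  (Y : T -> \bar R) : Prop :=
  [/\ forall U : set (\bar R), measurable U -> G (Y @^-1` U),
      forall x, 0 <= Y x &
      forall E, G E -> \int[P]_(x in E) Y x = \int[P]_(x in E) (X x)%:E].

End Prob.

(* Main.v *)
(* Put h_k = B^{1/2} r_k and W_k = B^{1/2} A S_k. One step of the iteration is
   h_k = (I - Pi_k) h_{k-1}, with Pi_k the orthogonal projection onto col(W_k),
   so |P h_k| is nonincreasing and |g_i| <= M_j for all i >= j. Given F_i, the
   gradient g_i is frozen and S_{i+1} is independent, so the JL moment bound at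
   z = g_i and at the parameter t/lam bounds the conditional exponential moment
   of the i-th summand by exp(c), c = (t/lam)^2 M_j^4 / (2Cp). Peeling off the
   lam summands one at a time yields exp(lam c), which is already smaller than
   the harmonic bound, since the harmonic sum is at least 1.
   Borel measurability of the iterates needs no limit argument: Pi_k is computed
   by Gram-Schmidt, a finite sequence of arithmetic operations. *)
Require Import Defs.
From HB Require Import structures.
From mathcomp Require Import all_boot all_order all_algebra.
From mathcomp Require Import all_classical all_reals all_analysis.
From mathcomp Require Import ring lra.
Import Order.TTheory GRing.Theory Num.Theory.
Local Open Scope classical_set_scope.
Local Open Scope ring_scope.
Set Implicit Arguments.
Unset Strict Implicit.
Unset Printing Implicit Defensive.

(** * Linear algebra *)

Section LinearAlgebra.
Context {R : realType}.

Lemma sqr_norm2 (k : nat) (v : 'cV[R]_k) : norm2 v ^+ 2 = \sum_i v i 0 ^+ 2.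
Proof. by rewrite sqr_sqrtr// sumr_ge0// => i _; exact: sqr_ge0. Qed.

Lemma norm2_dot (k : nat) (v : 'cV[R]_k) : norm2 v ^+ 2 = (v^T *m v) 0 0.
Proof.
by rewrite sqr_norm2 mxE; apply: eq_bigr => i _; rewrite mxE expr2.
Qed.

Lemma dot_scalar_mx (k : nat) (v : 'cV[R]_k) : v^T *m v = (norm2 v ^+ 2)%:M.
Proof.
by apply/matrixP => i j; rewrite !ord1 [RHS]mxE eqxx mulr1n -norm2_dot.
Qed.

Lemma norm2_ge0 (k : nat) (v : 'cV[R]_k) : 0 <= norm2 v.
Proof. exact: sqrtr_ge0. Qed.

Lemma norm2_eq0 (k : nat) (v : 'cV[R]_k) : norm2 v = 0 -> v = 0.
Proof.
move=> v0; have := sqr_norm2 v; rewrite v0 expr0n/= => /esym/eqP.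
rewrite psumr_eq0 => [/allP H|i _]; last exact: sqr_ge0.
apply/colP => i; rewrite mxE; apply/eqP; rewrite -sqrf_eq0.
by apply: (H i); rewrite mem_index_enum.
Qed.

Lemma norm20 (k : nat) : norm2 (0 : 'cV[R]_k) = 0.
Proof.
apply/eqP; rewrite -sqrf_eq0 sqr_norm2 big1// => i _.
by rewrite mxE expr0n.
Qed.

Lemma norm2Z (k : nat) (a : R) (v : 'cV[R]_k) :
  0 <= a -> norm2 (a *: v) = a * norm2 v.
Proof.
move=> a0; apply/eqP; rewrite -(@eqrXn2 _ 2)// ?norm2_ge0 ?mulr_ge0 ?norm2_ge0//.
rewrite exprMn !sqr_norm2 mulr_sumr; apply/eqP; apply: eq_bigr => i _.
by rewrite mxE exprMn.
Qed.

Lemma gram_eq0 (k l : nat) (M : 'M[R]_(k, l)) : M^T *m M = 0 -> M = 0.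
Proof.
move=> M0; apply/matrixP => i j; rewrite [RHS]mxE.
have : (M^T *m M) j j = 0 by rewrite M0 mxE.
rewrite mxE => /eqP; rewrite psumr_eq0; last first.
  by move=> a _; rewrite mxE -expr2 sqr_ge0.
move=> /allP/(_ i); rewrite mem_index_enum => /(_ isT)/=.
by rewrite mxE -expr2 sqrf_eq0 => /eqP.
Qed.

(** Entries of a unit vector are at most 1 in absolute value. This crude bound is what makes the set
    under the [sup] of [opnorm2] bounded above. *)
Lemma norm2_mulmx_le_sum (k l : nat) (M : 'M[R]_(k, l)) (v : 'cV[R]_l) :
  norm2 v = 1 -> norm2 (M *m v) ^+ 2 <= \sum_i (\sum_j `|M i j|) ^+ 2.
Proof.
move=> v1; rewrite sqr_norm2; apply: ler_sum => i _.
rewrite -real_normK ?num_real// lerXn2r ?nnegrE ?sumr_ge0//.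
rewrite mxE (le_trans (ler_norm_sum _ _ _))//; apply: ler_sum => j _.
rewrite normrM ler_piMr// -(@ler_pXn2r _ 2)// ?nnegrE// expr1n.
rewrite real_normK ?num_real// -(expr1n R 2) -v1 sqr_norm2.
by rewrite (bigD1 j)//= lerDl sumr_ge0// => a _; exact: sqr_ge0.
Qed.

Lemma norm2_mulmx_le (k l : nat) (M : 'M[R]_(k, l)) (v : 'cV[R]_l) :
  norm2 (M *m v) <= opnorm2 M * norm2 v.
Proof.
have [->|v0] := eqVneq v 0; first by rewrite mulmx0 !norm20 mulr0.
have nv : 0 < norm2 v.
  by rewrite lt_neqAle norm2_ge0 andbT; apply: contra_neq v0 => /esym/norm2_eq0.
rewrite -ler_pdivrMr// mulrC -norm2Z ?invr_ge0 ?norm2_ge0// scalemxAr.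
have v1 : norm2 ((norm2 v)^-1 *: v) = 1.
  by rewrite norm2Z ?invr_ge0 ?norm2_ge0// mulVf// gt_eqF.
apply: ub_le_sup; last by exists ((norm2 v)^-1 *: v).
exists (Num.sqrt (\sum_i (\sum_j `|M i j|) ^+ 2)) => _ [w /= w1 <-].
rewrite -[norm2 _]ger0_norm ?norm2_ge0// -sqrtr_sqr ler_wsqrtr//.
exact: norm2_mulmx_le_sum.
Qed.

(** If [K] spans the kernel of [G *m G^T], then [G^T *m K^T] has zero Gram matrix, so [K *m G = 0],
    and [K = 0] by independence of the rows. *)
Lemma row_free_gram_unit (k l : nat) (G : 'M[R]_(k, l)) :
  row_free G -> G *m G^T \in unitmx.
Proof.
move=> fG; rewrite -row_free_unit -kermx_eq0; apply/eqP.
set K := kermx _; have KG : K *m (G *m G^T) = 0 by exact: mulmx_ker.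
have : (G^T *m K^T)^T *m (G^T *m K^T) = 0.
  by rewrite trmx_mul !trmxK !mulmxA -(mulmxA K) KG mul0mx.
move/gram_eq0/(congr1 trmx); rewrite trmx_mul !trmxK trmx0 => KG0.
by apply: (row_free_inj fG); rewrite KG0 mul0mx.
Qed.

(** The classical formula for the pseudoinverse of a full-rank factorization: [M *m X] and [X *m M]
    reduce to the symmetric projections onto the column space of [F] and the row space of [G]. *)
Lemma penrose_full_rank (k r l : nat) (F : 'M[R]_(k, r)) (G : 'M[R]_(r, l)) :
  F^T *m F \in unitmx -> G *m G^T \in unitmx ->
  penrose (F *m G) (G^T *m invmx (G *m G^T) *m invmx (F^T *m F) *m F^T).
Proof.
move=> uF uG; set M := F *m G.
have MFG : M = F *m G by [].
set X := _ *m F^T.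
have GX : G *m X = invmx (F^T *m F) *m F^T.
  by rewrite /X !mulmxA (mulmxV uG) mul1mx.
have XF : X *m F = G^T *m invmx (G *m G^T).
  by rewrite /X -!mulmxA (mulVmx uF) mulmx1.
have MX : M *m X = F *m invmx (F^T *m F) *m F^T.
  by rewrite MFG -mulmxA GX mulmxA.
have XM : X *m M = G^T *m invmx (G *m G^T) *m G.
  by rewrite MFG mulmxA XF.
split.
- by rewrite MX /M (mulmxA _ F) -(mulmxA _ F^T F) -(mulmxA F) mulVmx// mulmx1.
- by rewrite XM -(mulmxA _ G) GX /X !mulmxA.
- by rewrite MX !trmx_mul trmx_inv !trmx_mul !trmxK !mulmxA.
- by rewrite XM !trmx_mul trmx_inv !trmx_mul !trmxK !mulmxA.
Qed.

(** Every matrix factors through its column and row bases, both of full rank. Existence guarantees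
    that the [xget] in [mpinv] does not fall back on its default value. *)
Lemma penrose_ex (k l : nat) (M : 'M[R]_(k, l)) : exists X, penrose M X.
Proof.
rewrite -(mulmx_base M); eexists; apply: penrose_full_rank.
  have -> : (col_base M)^T *m col_base M = (col_base M)^T *m (col_base M)^T^T.
    by rewrite trmxK.
  apply: row_free_gram_unit; rewrite -row_leq_rank mxrank_tr.
  by have := col_base_full M; rewrite -col_leq_rank.
by apply: row_free_gram_unit; exact: row_base_free.
Qed.

Lemma mpinvP (k l : nat) (M : 'M[R]_(k, l)) : penrose M (mpinv M).
Proof. by have [X MX] := penrose_ex M; exact: (xgetPex 0 (ex_intro _ X MX)). Qed.

(* Gram-Schmidt: the added term vanishes when u = 0, since 0^-1 = 0. *)
Fixpoint gs_proj (k : nat) (s : seq 'cV[R]_k) : 'M[R]_k :=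
  if s is w :: s' then
    let Q := gs_proj s' in let u := w - Q *m w in
    Q + (norm2 u ^+ 2)^-1 *: (u *m u^T)
  else 0.

(** An explicit counterpart of [orth_proj_col], whose choice operator would give no access to
    measurability in the entries of [W]. *)
Definition col_proj (k l : nat) (W : 'M[R]_(k, l)) : 'M[R]_k :=
  gs_proj [seq col j W | j <- enum 'I_l].

Lemma gs_proj_tr (k : nat) (s : seq 'cV[R]_k) : (gs_proj s)^T = gs_proj s.
Proof.
by elim: s => [|w s IH]/=; rewrite ?trmx0// linearD/= linearZ/= trmx_mul trmxK IH.
Qed.

(** The residual [u] satisfies [Q *m u = 0], so the cross terms vanish and the two summands are
    idempotent separately. *)
Lemma gs_proj_idem (k : nat) (s : seq 'cV[R]_k) :
  gs_proj s *m gs_proj s = gs_proj s.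
Proof.
elim: s => [|w s IH]/=; first by rewrite mul0mx.
set Q := gs_proj s; set u := w - _; set c := norm2 u ^+ 2.
have Qu : Q *m u = 0 by rewrite mulmxBr mulmxA IH subrr.
have uQ : u^T *m Q = 0.
  by rewrite -[Q]gs_proj_tr -trmx_mul Qu trmx0.
clearbody u.
rewrite mulmxDr !mulmxDl IH -!scalemxAl -!scalemxAr -!mulmxA uQ !mulmx0.
rewrite scaler0 addr0 (mulmxA Q) Qu mul0mx scaler0 add0r; congr (_ + _).
rewrite (mulmxA u^T) dot_scalar_mx -/c mul_scalar_mx -scalemxAr scalerA.
have [c0|c0] := eqVneq c 0; first by rewrite c0 invr0 mul0r !scale0r.
by rewrite mulVf// scale1r.
Qed.

(** An earlier vector is orthogonal to [u], so the new term does not move it. For the new vector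
    [v], the inner product of [u] with [v] is [c], and the new term gives back exactly
    [u = v - Q *m v]. *)
Lemma gs_proj_id (k : nat) (s : seq 'cV[R]_k) (w : 'cV[R]_k) :
  w \in s -> gs_proj s *m w = w.
Proof.
elim: s w => [//|v s IH] w /=; rewrite inE.
set Q := gs_proj s; set u := v - _; set c := norm2 u ^+ 2.
have Qu : Q *m u = 0 by rewrite mulmxBr mulmxA gs_proj_idem subrr.
have uQ : u^T *m Q = 0.
  by rewrite -[Q]gs_proj_tr -trmx_mul Qu trmx0.
move=> /orP[/eqP ->|ws]; rewrite mulmxDl -scalemxAl -mulmxA; last first.
  have -> : u^T *m w = 0 by rewrite -(IH _ ws) mulmxA uQ mul0mx.
  by rewrite mulmx0 scaler0 addr0 IH.
have -> : u^T *m v = c%:M.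
  have -> : v = u + Q *m v by rewrite subrK.
  by rewrite mulmxDr mulmxA uQ mul0mx addr0 dot_scalar_mx.
rewrite mul_mx_scalar scalerA.
(* If [c = 0] the new term is zero, but then [u = 0], that is, [v] is already fixed by [Q]. *)
have [c0|c0] := eqVneq c 0; last by rewrite mulVf// scale1r addrC subrK.
rewrite c0 mulr0 scale0r addr0; apply/eqP; rewrite eq_sym -subr_eq0; apply/eqP.
by apply: norm2_eq0; apply/eqP; rewrite -sqrf_eq0 -/c c0.
Qed.

Lemma gs_proj_sub (k l : nat) (s : seq 'cV[R]_k) (V : 'M[R]_(l, k)) :
  (forall w, w \in s -> (w^T <= V)%MS) -> (gs_proj s <= V)%MS.
Proof.
elim: s => [|w s IH]/= sV; first exact: sub0mx.
have QV : (gs_proj s <= V)%MS by apply: IH => v vs; rewrite sV// inE vs orbT.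
rewrite addmx_sub// scalemx_sub// mulmx_sub// linearB/= addmx_sub//.
  by rewrite sV// mem_head.
by rewrite eqmx_opp trmx_mul gs_proj_tr mulmx_sub.
Qed.

Lemma col_projP (k l : nat) (W : 'M[R]_(k, l)) : is_orth_proj_col W (col_proj W).
Proof.
split; [exact: gs_proj_tr|exact: gs_proj_idem|].
rewrite gs_proj_tr; apply/eqmxP/andP; split.
  apply: gs_proj_sub => _ /mapP[j _ ->].
  by rewrite tr_col row_sub.
apply/row_subP => j; rewrite -tr_col.
have Wj : col_proj W *m col j W = col j W.
  by apply: gs_proj_id; apply: map_f; rewrite mem_enum.
by rewrite -Wj trmx_mul gs_proj_tr submxMl.
Qed.

Lemma orth_proj_colP (k l : nat) (W : 'M[R]_(k, l)) :
  is_orth_proj_col W (orth_proj_col W).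
Proof. exact: (xgetPex 0 (ex_intro _ _ (col_projP W))). Qed.

Lemma orth_proj_id (k l : nat) (W : 'M[R]_(k, l)) (Q : 'M[R]_k) :
  is_orth_proj_col W Q -> Q *m W = W.
Proof.
move=> [Qs QQ QW]; have /submxP[D WD] : (W^T <= Q)%MS.
  by rewrite -[X in (_ <= X)%MS]Qs QW.
have -> : W = Q *m D^T by rewrite -[LHS]trmxK WD trmx_mul Qs.
by rewrite mulmxA QQ.
Qed.

Lemma orth_proj_factor (k l : nat) (W : 'M[R]_(k, l)) (Q : 'M[R]_k) :
  is_orth_proj_col W Q -> exists Z, Q = W *m Z.
Proof.
move=> [Qs QQ QW]; have /submxP[D QD] : (Q <= W^T)%MS by rewrite -{1}Qs QW.
by exists D^T; rewrite -[LHS]Qs QD trmx_mul trmxK.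
Qed.

(** With [N = W^T *m W], the equation [N *m X *m N = N] makes the Gram matrix of [W *m X *m N - W]
    vanish, hence [W *m X *m N = W]. Both sides then equal [W *m X *m W^T *m col_proj W], since
    [col_proj W] factors as [W *m Z] and fixes [W]. *)
Lemma mpinv_gram_col_proj (k l : nat) (W : 'M[R]_(k, l)) :
  W *m mpinv (W^T *m W) *m W^T = col_proj W.
Proof.
have [NXN _ _ _] := mpinvP (W^T *m W); set X := mpinv _ in NXN *.
have WXN : W *m X *m W^T *m W = W.
  have -> : W *m X *m W^T *m W = W *m (X *m (W^T *m W)) by rewrite !mulmxA.
  apply/eqP; rewrite -subr_eq0 -[X in _ - X]mulmx1 -mulmxBr; apply/eqP/gram_eq0.
  rewrite trmx_mul -mulmxA (mulmxA W^T) mulmxBr mulmx1 (mulmxA _ X) NXN.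
  by rewrite subrr mulmx0.
have QP := col_projP W; have [Z QZ] := orth_proj_factor QP.
have [Qs _ _] := QP.
transitivity (W *m X *m W^T *m col_proj W); last by rewrite QZ mulmxA WXN.
by rewrite -[RHS](mulmxA _ W^T) -Qs -trmx_mul (orth_proj_id QP).
Qed.

(** Pythagoras for the orthogonal splitting of [y] into [Q *m y] and its complement. *)
Lemma norm2_sub_proj (k : nat) (Q : 'M[R]_k) (y : 'cV[R]_k) :
  Q^T = Q -> Q *m Q = Q -> norm2 (y - Q *m y) <= norm2 y.
Proof.
move=> Qs QQ; rewrite -(@ler_pXn2r _ 2)// ?nnegrE ?norm2_ge0//.
have -> : norm2 (y - Q *m y) ^+ 2 = norm2 y ^+ 2 - norm2 (Q *m y) ^+ 2.
  rewrite !norm2_dot [(_ - _)^T]linearB/= mulmxBr !mulmxBl trmx_mul Qs !mulmxA.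
  by rewrite -(mulmxA _ Q Q) QQ subrr subr0 !mxE.
by rewrite gerBl sqr_ge0.
Qed.

Lemma opnorm2_ge0 (k l : nat) (M : 'M[R]_(k, l)) : 0 <= opnorm2 M.
Proof.
rewrite /opnorm2; set E := [set _ | _ in _].
(* When there is no unit vector ([l = 0]), [sup] takes its default value 0. *)
have [[[e Ee] ubE]|nE] := pselect (has_sup E); last by rewrite sup_out.
have e0 : 0 <= e by case: Ee => v _ <-; exact: norm2_ge0.
by rewrite (le_trans e0)// ub_le_sup.
Qed.

End LinearAlgebra.

(** * Decay of the projected residual and the uniform gradient bound *)

Section Iteration.
Context {R : realType} (m n p : nat) (A : 'M[R]_(m, n)) (b : 'cV[R]_m)
  (B Bh : 'M[R]_m) (x0 : 'cV[R]_n).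
Hypotheses (BhT : Bh^T = Bh) (BhB : Bh *m Bh = B).
Implicit Types S : nat -> 'M[R]_(n, p).

Let h S k := Bh *m resid A b B x0 S k.

(** Multiplying the update by [Bh *m A] turns its correction into [W *m mpinv (W^T *m W) *m W^T]
    applied to the scaled residual. This removes the pseudoinverse from the recursion. *)
Lemma scaled_resid_step S k :
  h S k.+1 = h S k - col_proj (Bh *m A *m S k.+1) *m h S k.
Proof.
set W := Bh *m A *m S k.+1.
rewrite -mpinv_gram_col_proj /h /resid /= -/(resid A b B x0 S k).
set r := resid A b B x0 S k; set N := mpinv _.
have WW : (S k.+1)^T *m A^T *m B *m A *m S k.+1 = W^T *m W.
  by rewrite /W !trmx_mul BhT -BhB !mulmxA.
rewrite -WW -/N [A *m (_ - _)]mulmxBr addrAC -/(resid A b B x0 S k) -/r.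
rewrite mulmxBr.
by rewrite /W !trmx_mul BhT -BhB !mulmxA.
Qed.

Lemma grad_scaled S k : grad A b B x0 S k = A^T *m Bh *m h S k.
Proof. by rewrite /grad /h -BhB !mulmxA. Qed.

Let Q := orth_proj_col (Bh *m A).

(** The columns of [W] lie in those of [Bh *m A], so [Q] absorbs [col_proj W] on either side. Hence
    the projected residual obeys the same recursion and loses its component along [W]. *)
Lemma norm2_proj_resid_step S k : norm2 (Q *m h S k.+1) <= norm2 (Q *m h S k).
Proof.
have QP : is_orth_proj_col (Bh *m A) Q by exact: orth_proj_colP.
set W := Bh *m A *m S k.+1.
have WP := col_projP W; have [Z WZ] := orth_proj_factor WP.
have [Ws WW _] := WP; have [Qs _ _] := QP.
have QW : Q *m col_proj W = col_proj W.
  by rewrite WZ mulmxA /W mulmxA (orth_proj_id QP).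
have WQ : col_proj W *m Q = col_proj W.
  by rewrite -[LHS]trmxK trmx_mul Ws Qs QW Ws.
rewrite scaled_resid_step mulmxBr -/W (mulmxA Q (col_proj W)) QW.
rewrite -[X in _ - X *m _]WQ -(mulmxA _ Q).
exact: norm2_sub_proj.
Qed.

Lemma norm2_proj_resid_le S j k : (j <= k)%N ->
  norm2 (Q *m h S k) <= norm2 (Q *m h S j).
Proof.
move=> /subnK <-; elim: (k - j)%N => [//|i IH].
by rewrite addSn (le_trans (norm2_proj_resid_step _ _)).
Qed.

(** Transposing [Q *m (Bh *m A) = Bh *m A] shows that the gradient depends only on the projected
    scaled residual, whose norm does not increase after time [j]. *)
Lemma norm2_grad_le S j k : (j <= k)%N ->
  norm2 (grad A b B x0 S k) <= Mconst A b B x0 Bh S j.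
Proof.
move=> jk; have QP : is_orth_proj_col (Bh *m A) Q by exact: orth_proj_colP.
have [Qs _ _] := QP.
have -> : grad A b B x0 S k = A^T *m Bh *m (Q *m h S k).
  have -> : A^T *m Bh *m (Q *m h S k) = A^T *m Bh *m Q *m h S k by rewrite !mulmxA.
  rewrite grad_scaled; congr (_ *m _); have := orth_proj_id QP.
  by move=> /(congr1 trmx); rewrite !trmx_mul Qs BhT.
rewrite (le_trans (norm2_mulmx_le _ _))// /Mconst -mulmxA ler_wpM2l//.
  exact: opnorm2_ge0.
exact: norm2_proj_resid_le.
Qed.

End Iteration.

(** * Independence and freezing *)

Section Independence.
Context d (T : measurableType d) (R : realType) (P : probability T R).
Local Open Scope ereal_scope.

(** Both sides are finite measures in [A], the restriction of [P] to [B] and a multiple of [P]. They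
    agree on a pi-system containing the whole space, hence on the sigma-algebra it generates. *)
Lemma indep_generatedl (G : set (set T)) (B : set T) :
  G `<=` measurable -> setI_closed G -> G setT -> measurable B ->
  (forall A, G A -> P (A `&` B) = P A * P B) ->
  forall A, <<s G >> A -> P (A `&` B) = P A * P B.
Proof.
move=> Gm GI GT mB GB A GA.
have PB0 : (0 <= fine (P B))%R by rewrite fine_ge0.
pose c : {nonneg R} := NngNum PB0.
have PBE : P B = (fine (P B))%:E by rewrite fineK// fin_num_measure.
rewrite -[LHS]/(mrestr P mB A) muleC PBE -[RHS]/(mscale c P A).
apply: (g_sigma_algebra_measure_unique G Gm (fun=> setT)) => //.
- by rewrite bigcup_const//; exists 0%N.
- by move=> E GE; rewrite [LHS]GB// muleC PBE.
- move=> _; rewrite [X in X < _](_ : _ = P (setT `&` B))//.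
  by rewrite setTI -ge0_fin_numE// fin_num_measure.
Qed.

Lemma indep_generated (G1 G2 : set (set T)) :
  G1 `<=` measurable -> setI_closed G1 -> G1 setT ->
  G2 `<=` measurable -> setI_closed G2 -> G2 setT ->
  (forall A B, G1 A -> G2 B -> P (A `&` B) = P A * P B) ->
  forall A B, <<s G1 >> A -> <<s G2 >> B -> P (A `&` B) = P A * P B.
Proof.
move=> G1m G1I G1T G2m G2I G2T G12 A B G1A G2B.
have mA : measurable A.
  by apply: smallest_sub G1A => //; exact: sigma_algebra_measurable.
rewrite setIC muleC; apply: (indep_generatedl G2m) => // E GE.
rewrite setIC muleC; apply: (indep_generatedl G1m) => //; first exact: G2m.
by move=> F GF; exact: G12.
Qed.

Lemma measurable_id_sub (G : set (set T)) : <<s G >> `<=` measurable ->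
  measurable_fun setT (id : T -> g_sigma_algebraType G).
Proof. by move=> Gm _ Y GY; rewrite setTI; exact: Gm. Qed.

Lemma measurable_fun_sub d' (U : measurableType d') (G : set (set T))
    (f : T -> U) : <<s G >> `<=` measurable ->
  measurable_fun setT (f : g_sigma_algebraType G -> U) -> measurable_fun setT f.
Proof.
move=> Gm mf.
exact: (@measurableT_comp _ _ _ T (g_sigma_algebraType G) U f setT id mf
  (measurable_id_sub Gm)).
Qed.

(* Freezing: under independence, the law of the diagonal x |-> (x, x) on the
   product of the two sub-sigma-algebras is the product of the restrictions of P. *)
Lemma le_indep_integral (G1 G2 : set (set T))
    (f : g_sigma_algebraType G1 * g_sigma_algebraType G2 -> \bar R)
    (h : g_sigma_algebraType G1 -> \bar R) :
  <<s G1 >> `<=` measurable -> <<s G2 >> `<=` measurable ->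
  (forall A B, <<s G1 >> A -> <<s G2 >> B -> P (A `&` B) = P A * P B) ->
  measurable_fun setT f -> (forall z, 0 <= f z) -> measurable_fun setT h ->
  (forall x, \int[P]_y f (x, y) <= h x) ->
  \int[P]_x f (x, x) <= \int[P]_x h x.
Proof.
move=> G1m G2m G12 mf f0 mh fh.
pose T1 := g_sigma_algebraType G1; pose T2 := g_sigma_algebraType G2.
have m1 := measurable_id_sub G1m; have m2 := measurable_id_sub G2m.
have mD : measurable_fun setT ((fun x => (x, x)) : T -> T1 * T2).
  exact: measurable_fun_pair.
pose i1 : {mfun T >-> T1} := HB.pack (id : T -> T1) (isMeasurableFun.Build _ _ _ _ _ m1).
pose i2 : {mfun T >-> T2} := HB.pack (id : T -> T2) (isMeasurableFun.Build _ _ _ _ _ m2).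
pose D : {mfun T >-> (T1 * T2)%type} := HB.pack ((fun x => (x, x)) : T -> T1 * T2)
  (isMeasurableFun.Build _ _ _ _ _ mD).
have F0 x : 0 <= fubini_F (distribution P i2) f x by exact: integral_ge0.
have Fh x : fubini_F (distribution P i2) f x <= h x.
  rewrite (le_trans _ (fh x))// /fubini_F ge0_integral_distribution//.
  exact: measurableT_comp.
have -> : \int[P]_x f (x, x) = \int[distribution P D]_z f z.
  by rewrite ge0_integral_distribution.
have -> : \int[distribution P D]_z f z =
    \int[distribution P i1 \x distribution P i2]_z f z.
  apply: eq_measure_integral => A mA _; exact/esym/product_measure_unique.
have -> : \int[P]_x h x = \int[distribution P i1]_x h x.
  by rewrite ge0_integral_distribution// => x; exact: le_trans (Fh x).
rewrite (fubini_tonelli1 f mf f0).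
apply: ge0_le_integral => //.
exact: measurable_fun_fubini_tonelli_F.
Qed.

(** The set where [Y] exceeds [g] is the union of the sets [E N] on which [g] is at most [N] and [Y]
    exceeds it by at least [N.+1%:R^-1]. Testing the hypothesis on [E N] forces [P (E N) = 0]. *)
Lemma ae_le_of_integral_le (G : set (set T)) (Y : g_sigma_algebraType G -> \bar R)
    (g : g_sigma_algebraType G -> R) :
  <<s G >> `<=` measurable -> measurable_fun setT Y -> measurable_fun setT g ->
  (forall x, 0 <= Y x) -> (forall x, (0 <= g x)%R) ->
  (forall E, <<s G >> E -> \int[P]_(x in E) Y x <= \int[P]_(x in E) (g x)%:E) ->
  {ae P, forall x, Y x <= (g x)%:E}.
Proof.
move=> Gm mY mg Y0 g0 H.
pose E N := [set x : g_sigma_algebraType G |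
  ((g x)%:E <= N%:R%:E) && ((g x + N.+1%:R^-1)%:E <= Y x)].
have GE N : <<s G >> (E N).
  pose q (x : g_sigma_algebraType G) :=
    ((g x)%:E <= N%:R%:E) && ((g x + N.+1%:R^-1)%:E <= Y x).
  have mq : measurable_fun setT q.
    apply: measurable_and; apply: measurable_fun_lee => //.
      exact/measurable_EFinP.
    by apply/measurable_EFinP; exact: measurable_funD.
  have := mq measurableT [set true] I.
  rewrite setTI (_ : _ @^-1` _ = E N)//.
have mE N : d.-measurable (E N : set T) by apply: Gm; exact: GE.
have mYP : measurable_fun setT (Y : T -> _) by exact: measurable_fun_sub mY.
have mgP : measurable_fun setT (g : T -> _) by exact: measurable_fun_sub mg.
have PE0 N : P (E N) = 0.
  (* The cap [N] on [g] makes this integral finite, so that it can be cancelled below. *)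
  have Ng : \int[P]_(x in E N) (g x)%:E \is a fin_num.
    rewrite ge0_fin_numE ?integral_ge0// => [|x _]; last by rewrite lee_fin.
    apply: (@le_lt_trans _ _ (\int[P]_(x in E N) N%:R%:E)).
      apply: ge0_le_integral => //.
      - by move=> x _; rewrite lee_fin.
      - by apply/measurable_EFinP; exact: measurable_funTS.
      - by move=> x /andP[].
    by rewrite integral_cst// lte_mul_pinfty// -ge0_fin_numE// fin_num_measure.
  have : \int[P]_(x in E N) ((g x)%:E + N.+1%:R^-1%:E) <= \int[P]_(x in E N) (g x)%:E.
    rewrite (le_trans _ (H _ (GE N)))//; apply: ge0_le_integral => //.
    - by move=> x _; rewrite -EFinD lee_fin addr_ge0.
    - apply/measurable_EFinP; apply: measurable_funTS.
      exact: measurable_funD.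
    - exact: measurable_funTS.
    - by move=> x /andP[].
  rewrite ge0_integralD//; last 2 first.
  - by move=> x _; rewrite lee_fin.
  - by apply/measurable_EFinP; exact: measurable_funTS.
  rewrite integral_cst// -[X in _ <= X]adde0 leeD2lE// pmule_rle0 ?lte_fin ?invr_gt0// => PN.
  by apply/eqP; rewrite -measure_le0.
suff : P.-negligible (\bigcup_N E N).
  apply: negligibleS => x /= /negP; rewrite -ltNge => gY.
  have [e e0 geY] : exists2 e : R, (0 < e)%R & (g x + e)%:E <= Y x.
    case: (Y x) gY => [r| |]//; last by exists 1%R => //; rewrite leey.
    by rewrite lte_fin -subr_gt0 => gr; exists (r - g x)%R => //; rewrite subrKC.
  (* One index large enough for both conditions: [N] dominates [g x], and [N.+1] dominates
     [e^-1]. *)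
  pose N := maxn (Num.truncn (g x)).+1 (Num.truncn e^-1).
  exists N => //; apply/andP; split.
    rewrite lee_fin (le_trans (ltW (truncnS_gt _)))// ler_nat leq_maxl//.
  rewrite (le_trans _ geY)// lee_fin lerD2l invf_ple ?posrE//.
  by rewrite (le_trans (ltW (truncnS_gt _)))// ler_nat ltnS leq_maxr.
apply: (@negligible_bigcup _ T _ P E) => N.
by apply/(negligibleP P (mE N)); exact: PE0.
Qed.

End Independence.

(** * Measurability of the iteration *)

Section MeasurableMatrix.
Context {R : realType} d (T : measurableType d).

Definition mx_measurable (k l : nat) (X : T -> 'M[R]_(k, l)) :=
  forall i j, measurable_fun setT (fun x => X x i j).

Lemma mx_measurable_cst (k l : nat) (M : 'M[R]_(k, l)) :
  mx_measurable (fun=> M).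
Proof. by move=> i j; exact: measurable_cst. Qed.

Lemma mx_measurable_trmx (k l : nat) (X : T -> 'M[R]_(k, l)) :
  mx_measurable X -> mx_measurable (fun x => (X x)^T).
Proof.
by move=> mX i j; under eq_fun do rewrite mxE; exact: mX.
Qed.

Lemma mx_measurableD (k l : nat) (X Y : T -> 'M[R]_(k, l)) :
  mx_measurable X -> mx_measurable Y -> mx_measurable (fun x => X x + Y x).
Proof.
by move=> mX mY i j; under eq_fun do rewrite mxE; exact: measurable_funD.
Qed.

Lemma mx_measurableB (k l : nat) (X Y : T -> 'M[R]_(k, l)) :
  mx_measurable X -> mx_measurable Y -> mx_measurable (fun x => X x - Y x).
Proof.
by move=> mX mY i j; under eq_fun do rewrite !mxE; exact: measurable_funB.
Qed.

Lemma mx_measurableM (k l q : nat) (X : T -> 'M[R]_(k, l)) (Y : T -> 'M[R]_(l, q)) :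
  mx_measurable X -> mx_measurable Y -> mx_measurable (fun x => X x *m Y x).
Proof.
move=> mX mY i j; under eq_fun do rewrite mxE.
by apply: measurable_sum => a; exact: measurable_funM.
Qed.

Lemma measurable_sqr_norm2 (k : nat) (u : T -> 'cV[R]_k) :
  mx_measurable u -> measurable_fun setT (fun x => norm2 (u x) ^+ 2).
Proof.
move=> mu; under eq_fun do rewrite sqr_norm2.
by apply: measurable_sum => i; exact: measurable_funX.
Qed.

Lemma mx_measurable_gs_proj (k : nat) (I : Type) (s : seq I) (u : I -> T -> 'cV[R]_k) :
  (forall i, mx_measurable (u i)) ->
  mx_measurable (fun x => gs_proj [seq u i x | i <- s]).
Proof.
move=> mu; elim: s => [|i s IH] /=; first exact: mx_measurable_cst.
apply: mx_measurableD => //.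
set v := fun x => u i x - gs_proj [seq u i x | i <- s] *m u i x.
have mv : mx_measurable v by apply: mx_measurableB => //; exact: mx_measurableM.
(* The only operation here that is not polynomial is the inverse. It is measurable as the real power
   with exponent -1, with which it agrees on nonnegative numbers, zero included. *)
move=> a c; under eq_fun do rewrite mxE -powR_inv1 ?sqr_ge0//.
apply: measurable_funM.
  apply: (@measurableT_comp _ _ _ _ _ _ (fun r => r `^ (-1))).
    exact: measurable_powR.
  exact: (measurable_sqr_norm2 mv).
exact: (mx_measurableM mv (mx_measurable_trmx mv)).
Qed.

Lemma mx_measurable_col_proj (k l : nat) (W : T -> 'M[R]_(k, l)) :
  mx_measurable W -> mx_measurable (fun x => col_proj (W x)).
Proof.
move=> mW; apply: (mx_measurable_gs_proj _ (u := fun j x => col j (W x))) => j a c.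
by under eq_fun do rewrite mxE; exact: mW.
Qed.

End MeasurableMatrix.

Section MeasurableIteration.
Context {R : realType} d (T : measurableType d) (m n p : nat).
Context (A : 'M[R]_(m, n)) (b : 'cV[R]_m) (B Bh : 'M[R]_m) (x0 : 'cV[R]_n).
Context (BhT : Bh^T = Bh) (BhB : Bh *m Bh = B).
Context (S : nat -> T -> 'M[R]_(n, p)) (k : nat).
Context (mS : forall i, (1 <= i <= k)%N -> mx_measurable (S i)).

(** The induction follows the scaled residuals rather than the iterates, because their recursion
    involves [col_proj] instead of [mpinv]. *)
Lemma mx_measurable_scaled_resid i : (i <= k)%N ->
  mx_measurable (fun x => Bh *m resid A b B x0 (S^~ x) i).
Proof.
elim: i => [|i IH] ik; first exact: (mx_measurable_cst (Bh *m (A *m x0 - b))).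
under eq_fun do rewrite (scaled_resid_step _ _ _ BhT BhB).
have mh := IH (ltnW ik).
apply: mx_measurableB => //; apply: mx_measurableM => //.
apply: mx_measurable_col_proj; apply: mx_measurableM; last exact: mS.
exact: mx_measurable_cst.
Qed.

Lemma mx_measurable_grad i : (i <= k)%N ->
  mx_measurable (fun x => grad A b B x0 (S^~ x) i).
Proof.
move=> ik; under eq_fun do rewrite (grad_scaled _ _ _ BhB).
apply: mx_measurableM; first exact: mx_measurable_cst.
exact: mx_measurable_scaled_resid.
Qed.

(** The inequality is strict because the sketched gradient at time [i] involves the sketch of index
    [i.+1]. *)
Lemma mx_measurable_sgrad i : (i < k)%N ->
  mx_measurable (fun x => sgrad A b B x0 (S^~ x) i).
Proof.
move=> ik; apply: mx_measurableM; last exact: (mx_measurable_grad (ltnW ik)).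
by apply: mx_measurable_trmx; exact: mS.
Qed.

Lemma measurable_sqr_Mconst i : (i <= k)%N ->
  measurable_fun setT (fun x => Mconst A b B x0 Bh (S^~ x) i ^+ 2).
Proof.
move=> ik; under eq_fun do rewrite /Mconst exprMn -mulmxA.
apply: measurable_funM => //; apply: measurable_sqr_norm2.
apply: mx_measurableM; first exact: mx_measurable_cst.
exact: mx_measurable_scaled_resid.
Qed.

End MeasurableIteration.

(** * The filtration of the sketches and its independence of the next sketch *)

Section Filtration.
Context {R : realType} d (T : measurableType d) (P : probability T R) (n p : nat).
Context (S : nat -> T -> 'M[R]_(n, p)) (iidS : iid P S).

(** The generating family of [filt S j], named so that [g_sigma_algebraType] can be formed on it. *)
Definition filt_gen (j : nat) : set (set T) :=
  \bigcup_(i in [set i : nat | (1 <= i <= j)%N]) sigma_of (S i).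

Lemma sigma_of_setI i : setI_closed (sigma_of (S i)).
Proof.
move=> _ _ [H mH <-] [H' mH' <-]; exists (H `&` H') => //.
have /sigma_algebraP[//|_ _ _ +] := smallest_sigma_algebra [set: 'M[R]_(n, p)]
  [set E | exists (a : 'I_n) (c : 'I_p) (Y : set R),
    measurable Y /\ E = [set M : 'M[R]_(n, p) | Y (M a c)]].
exact.
Qed.

Lemma sigma_of_setT i : sigma_of (S i) setT.
Proof.
exists setT => //; have [m0 mC _] := smallest_sigma_algebra [set: 'M[R]_(n, p)]
  [set E | exists (a : 'I_n) (c : 'I_p) (Y : set R),
    measurable Y /\ E = [set M : 'M[R]_(n, p) | Y (M a c)]].
by rewrite -(setD0 setT); exact: mC.
Qed.

Lemma sigma_of_measurable i : (1 <= i)%N -> sigma_of (S i) `<=` measurable.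
Proof. by case: i => // i _ _ [H mH <-]; have [+ _ _] := iidS; exact. Qed.

Lemma filt_gen_measurable j : <<s filt_gen j >> `<=` measurable.
Proof.
apply: smallest_sub; first exact: sigma_algebra_measurable.
by move=> E [i /andP[i1 _]]; exact: sigma_of_measurable.
Qed.

Lemma mx_measurable_filt i j : (1 <= i <= j)%N ->
  mx_measurable (S i : g_sigma_algebraType (filt_gen j) -> 'M[R]_(n, p)).
Proof.
move=> ij a c _ Y mY; rewrite setTI; apply: sub_sigma_algebra.
exists i => //; exists [set M : 'M[R]_(n, p) | Y (M a c)] => //.
by apply: sub_sigma_algebra; exists a, c, Y.
Qed.

Lemma mx_measurable_sigma_of i :
  mx_measurable (S i : g_sigma_algebraType (sigma_of (S i)) -> 'M[R]_(n, p)).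
Proof.
move=> a c _ Y mY; rewrite setTI; apply: sub_sigma_algebra.
exists [set M : 'M[R]_(n, p) | Y (M a c)] => //.
by apply: sub_sigma_algebra; exists a, c, Y.
Qed.

Lemma measurable_fun_filt_le i j d' (U : measurableType d') (f : T -> U) :
  (i <= j)%N ->
  measurable_fun setT (f : g_sigma_algebraType (filt_gen i) -> U) ->
  measurable_fun setT (f : g_sigma_algebraType (filt_gen j) -> U).
Proof.
move=> ij mf _ Y mY; have := mf measurableT Y mY.
apply: sub_sigma_algebra2 => E [l /andP[l1 li] SE].
by exists l => //=; rewrite l1 (leq_trans li).
Qed.

(** A pi-system containing [filt_gen j], which is itself only a union of sigma-algebras. Each member
    takes one event per sketch. *)
Definition cylinders (j : nat) : set (set T) :=
  [set A | exists2 E : nat -> set T,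
    (forall i, sigma_of (S i) (E i)) & A = \big[setI/setT]_(i <- iota 1 j) E i].

Lemma cylinders_setI j : setI_closed (cylinders j).
Proof.
move=> _ _ [E SE ->] [F SF ->]; exists (fun i => E i `&` F i).
  by move=> i; exact: sigma_of_setI.
by rewrite big_split.
Qed.

Lemma filt_gen_cylinders j : filt_gen j `<=` cylinders j.
Proof.
move=> A [i /= ij SA]; exists (fun l => if l == i then A else setT).
  by move=> l; case: eqP => [->//|_]; exact: sigma_of_setT.
rewrite (bigD1_seq i) ?iota_uniq ?mem_iota ?add1n ?ltnS//= eqxx big1 ?setIT//.
by move=> l /negbTE ->.
Qed.

Lemma cylinders_measurable j : cylinders j `<=` measurable.
Proof.
move=> _ [E SE ->]; rewrite big_seq; elim/big_ind: _ => //.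
  exact: measurableI.
by move=> i; rewrite mem_iota => /andP[i1 _]; exact: sigma_of_measurable (SE i).
Qed.

(** By the pi-system criterion it is enough to treat cylinders, where the product formula in [iid]
    applies to the indices 1 to [j] and again to [j.+1] together with them. *)
Lemma filt_gen_indep j (E H : set T) :
  <<s filt_gen j >> E -> <<s sigma_of (S j.+1) >> H ->
  P (E `&` H) = (P E * P H)%E.
Proof.
move=> /(sub_sigma_algebra2 (@filt_gen_cylinders j)).
move: E H; apply: indep_generated.
- exact: cylinders_measurable.
- exact: cylinders_setI.
- exists (fun=> setT); first by move=> i; exact: sigma_of_setT.
  by rewrite big1.
- exact: sigma_of_measurable.
- exact: sigma_of_setI.
- exact: sigma_of_setT.
- move=> _ H [E SE ->] SH; have [_ _ prodP] := iidS.
  (* A single family of events, with [H] placed at index [j.+1], in the form that the product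
     formula expects. *)
  pose F i := if i == j.+1 then H else E i.
  have SF i : sigma_of (S i) (F i) by rewrite /F; case: eqP => [->|].
  have EF i : i \in iota 1 j -> F i = E i.
    rewrite mem_iota add1n ltnS /F => /andP[_ ij].
    by case: eqP => // ij1; rewrite ij1 ltnn in ij.
  rewrite setIC muleC.
  have -> : \big[setI/setT]_(i <- iota 1 j) E i = \big[setI/setT]_(i <- iota 1 j) F i.
    by apply: eq_big_seq => i /EF.
  have HF : H = F j.+1 by rewrite /F eqxx.
  have all1 : all (leq 1) (iota 1 j).
    by apply/allP => i; rewrite mem_iota => /andP[].
  rewrite [X in P (X `&` _)]HF [X in (P X * _)%E]HF.
  rewrite (prodP (iota 1 j) F) ?iota_uniq//.
  have := prodP (j.+1 :: iota 1 j) F; rewrite !big_cons; apply => //=.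
  by rewrite iota_uniq mem_iota add1n ltnn andbF.
Qed.

End Filtration.

(** * The exponential moment bound *)

Section Supermartingale.
Context {R : realType} d (T : measurableType d) (P : probability T R) (n p : nat).
Context (S : nat -> T -> 'M[R]_(n, p)) (iidS : iid P S).
Local Notation F := (filt_gen S).
Local Notation GT j := (g_sigma_algebraType (F j)).
Local Open Scope ereal_scope.

(** Freezing with [U], [c] and [g] in the first variable and the new sketch in the second: the inner
    integral is at most [U x * expR (- c x) * expR (c x)]. The arbitrary weight [U] will carry a
    test event and all earlier factors. *)
Lemma exp_step_le (j : nat) (U c : T -> R) (g : T -> 'cV[R]_n) (s : R) :
  (forall x, 0 <= U x)%R ->
  measurable_fun setT (U : GT j -> R) -> measurable_fun setT (c : GT j -> R) ->
  mx_measurable (g : GT j -> 'cV[R]_n) ->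
  (forall x, \int[P]_y (expR (s * (norm2 ((S j.+1 y)^T *m g x) ^+ 2
                                   - norm2 (g x) ^+ 2)))%:E <= (expR (c x))%:E) ->
  \int[P]_x (U x * expR (s * (norm2 ((S j.+1 x)^T *m g x) ^+ 2
                              - norm2 (g x) ^+ 2) - c x))%:E
  <= \int[P]_x (U x)%:E.
Proof.
move=> U0 mU mc mg H.
pose f (z : GT j * g_sigma_algebraType (sigma_of (S j.+1))) :=
  (U z.1 * expR (s * (norm2 ((S j.+1 z.2)^T *m g z.1) ^+ 2
                      - norm2 (g z.1) ^+ 2) - c z.1))%:E.
have mg1 : mx_measurable (fun z : GT j * g_sigma_algebraType (sigma_of (S j.+1)) => g z.1).
  by move=> a b; apply: (measurableT_comp (mg a b)); exact: measurable_fst.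
have mS2 : mx_measurable
    (fun z : GT j * g_sigma_algebraType (sigma_of (S j.+1)) => S j.+1 z.2).
  move=> a b; apply: (measurableT_comp (@mx_measurable_sigma_of _ _ _ _ _ S j.+1 a b)).
  exact: measurable_snd.
apply: (@le_indep_integral _ T R P (F j) (sigma_of (S j.+1)) f (fun x => (U x)%:E)).
- exact: (filt_gen_measurable iidS).
- apply: smallest_sub; first exact: sigma_algebra_measurable.
  exact: (sigma_of_measurable iidS (ltn0Sn j)).
- exact: (filt_gen_indep iidS).
- apply/measurable_EFinP; apply: measurable_funM.
    by apply: (measurableT_comp mU); exact: measurable_fst.
  apply: measurableT_comp => //; apply: measurable_funB; last first.
    by apply: (measurableT_comp mc); exact: measurable_fst.
  apply: measurable_funM => //; apply: measurable_funB; last exact: measurable_sqr_norm2.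
  apply: measurable_sqr_norm2; apply: mx_measurableM => //.
  exact: mx_measurable_trmx.
- by move=> z; rewrite lee_fin mulr_ge0// expR_ge0.
- exact/measurable_EFinP.
- move=> x; rewrite /f/=.
  under eq_integral do rewrite expRD mulrA mulrAC EFinM.
  rewrite ge0_integralZl_EFin//; last 2 first.
  + apply/measurable_EFinP; apply: measurableT_comp => //.
    apply: measurable_funM => //; apply: measurable_funB => //.
    apply: measurable_sqr_norm2; apply: mx_measurableM; last exact: mx_measurable_cst.
    apply: mx_measurable_trmx => a b.
    apply: measurable_fun_sub (@mx_measurable_sigma_of _ _ _ _ _ S j.+1 a b).
    apply: smallest_sub; first exact: sigma_algebra_measurable.
    exact: (sigma_of_measurable iidS (ltn0Sn j)).
  + by rewrite mulr_ge0// expR_ge0.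
  rewrite (le_trans (lee_wpmul2l _ (H x)))// ?lee_fin ?mulr_ge0 ?expR_ge0//.
  by rewrite -mulrA -expRD addNr expR0 mulr1.
Qed.

End Supermartingale.

(** * Accumulating the one-step bounds over a window *)

Section WindowEstimator.
Context {R : realType} d (T : measurableType d) (P : probability T R) (m n p : nat).
Context (A : 'M[R]_(m, n)) (b : 'cV[R]_m) (B Bh : 'M[R]_m) (x0 : 'cV[R]_n).
Context (BhT : Bh^T = Bh) (BhB : Bh *m Bh = B).
Context (S : nat -> T -> 'M[R]_(n, p)) (iidS : iid P S).
Context (C omega s : R) (C0 : 0 < C) (JLS : forall i, JL P (S i.+1) C omega).
Context (s_le : `|s| <= omega^-1) (j : nat).
Local Notation F := (filt_gen S).
Local Notation GT j := (g_sigma_algebraType (F j)).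

Let D i x := s * (norm2 (sgrad A b B x0 (S^~ x) i) ^+ 2
                  - norm2 (grad A b B x0 (S^~ x) i) ^+ 2).
Let c x := s ^+ 2 * Mconst A b B x0 Bh (S^~ x) j ^+ 4 / (2 * C * p%:R).

Let measurable_c i : (j <= i)%N -> measurable_fun setT (c : GT i -> R).
Proof.
move=> ji; rewrite /c; under eq_fun do rewrite (exprM _ 2 2).
apply: measurable_funM => //; apply: measurable_funM => //.
apply: measurable_funX.
have mS q : (1 <= q <= i)%N -> mx_measurable (S q : GT i -> _).
  exact: mx_measurable_filt.
exact: (measurable_sqr_Mconst A b x0 BhT BhB mS).
Qed.

(** Induction on [l]: the last summand is split off and the rest, measurable at time [j + l], is
    absorbed into the weight. The compensator [c] is fixed at time [j], yet it serves every step
    because the gradient bound is uniform in later times. *)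
Lemma window_exp_le (U : T -> R) (l : nat) :
  (forall x, 0 <= U x) -> measurable_fun setT (U : GT j -> R) ->
  (\int[P]_x (U x * expR (\sum_(j <= i < j + l) D i x - l%:R * c x))%:E
   <= \int[P]_x (U x)%:E)%E.
Proof.
move=> U0 mU; elim: l => [|l IH].
  rewrite addn0; under eq_integral do
    rewrite big_geq// mul0r subr0 expR0 mulr1.
  by [].
apply: le_trans IH.
have mS q : (1 <= q <= j + l)%N -> mx_measurable (S q : GT (j + l) -> _).
  exact: mx_measurable_filt.
have mD i : (j <= i < j + l)%N -> measurable_fun setT (D i : GT (j + l) -> R).
  move=> /andP[ji il].
  apply: measurable_funM => //; apply: measurable_funB; apply: measurable_sqr_norm2.
    exact: (mx_measurable_sgrad A b x0 BhT BhB mS).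
  exact: (mx_measurable_grad A b x0 BhT BhB mS (ltnW il)).
pose V x := U x * expR (\sum_(j <= i < j + l) D i x - l%:R * c x).
have VE x : U x * expR (\sum_(j <= i < j + l.+1) D i x - l.+1%:R * c x) =
    V x * expR (s * (norm2 ((S (j + l).+1 x)^T *m grad A b B x0 (S^~ x) (j + l)) ^+ 2
                     - norm2 (grad A b B x0 (S^~ x) (j + l)) ^+ 2) - c x).
  rewrite /V -mulrA -expRD addnS big_nat_recr ?leq_addr//=; congr (_ * expR _).
  by rewrite -(natr1 l) mulrDl mul1r /D /sgrad; ring.
under eq_integral do rewrite VE.
apply: exp_step_le => //.
- by move=> x; rewrite mulr_ge0 ?expR_ge0.
- apply: measurable_funM; first exact: (measurable_fun_filt_le (leq_addr l j)).
  apply: measurableT_comp => //; apply: measurable_funB; last first.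
    by apply: measurable_funM => //; apply: measurable_c; exact: leq_addr.
  (* The guard extends the summand by 0 outside the window, since [measurable_sum] asks for
     measurability at every index. *)
  rewrite [X in measurable_fun _ X](_ : _ = fun x =>
      \sum_(j <= i < j + l) (if (j <= i < j + l)%N then D i x else 0)); last first.
    by apply/funext => x; apply: eq_big_nat => i ->.
  apply: measurable_sum => i; case ij: (j <= i < j + l)%N; last exact: measurable_cst.
  exact: mD.
- by apply: measurable_c; exact: leq_addr.
- exact: (mx_measurable_grad A b x0 BhT BhB mS).
- move=> x; have [_ H _] := JLS (j + l) (grad A b B x0 (S^~ x) (j + l)).
  rewrite (le_trans (H _ s_le))// lee_fin ler_expR /c.
  apply: ler_wpM2r; first by rewrite invr_ge0 !mulr_ge0 ?ler0n ?(ltW C0).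
  rewrite ler_wpM2l ?sqr_ge0// lerXn2r ?nnegrE ?norm2_ge0//.
    exact: le_trans (norm2_ge0 _) (norm2_grad_le A b x0 BhT BhB (S^~ x) (leqnn j)).
  exact: (norm2_grad_le A b x0 BhT BhB (S^~ x) (leq_addr l j)).
Qed.

End WindowEstimator.

(** Each increment of the logarithm dominates the next harmonic term, by [ln (1 + x) <= x] at
    [x = - l.+2%:R^-1]. *)
Lemma harmonic_le (R : realType) (l : nat) : (1 <= l)%N ->
  \sum_(1 <= j < l.+1) (j%:R : R)^-1 <= 1 + ln l%:R.
Proof.
case: l => // l _; elim: l => [|l IH].
  by rewrite big_nat1 invr1 ln1 addr0.
rewrite big_nat_recr//= (le_trans (lerD IH (lexx _)))// -addrA lerD2l.
have l1 : (0 : R) < l.+1%:R by rewrite ltr0n.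
have l2 : (0 : R) < l.+2%:R by rewrite ltr0n.
rewrite -lerBrDl.
suff : ln (l.+1%:R / l.+2%:R : R) <= - l.+2%:R^-1.
  by rewrite ln_div ?posrE// lerNr opprB.
have -> : l.+1%:R / l.+2%:R = 1 - l.+2%:R^-1 :> R.
  by rewrite -[l.+2%:R]natr1; field; rewrite gt_eqF//; lra.
apply: le_ln1Dx; rewrite ltrN2 invf_lt1// -[1]/(1%:R) ltr_nat//.
Qed.

Theorem mainTheorem8 (R : realType) (d : measure_display) (T : measurableType d)
  (P : probability T R) (m n p : nat) (A : 'M[R]_(m, n)) (b : 'cV[R]_m)
  (B Bh : 'M[R]_m) (x0 : 'cV[R]_n) (S : nat -> T -> 'M[R]_(n, p))
  (C omega delta : R) (lam k : nat) :
  sym_pd B -> sym_pd Bh -> Bh *m Bh = B ->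
  iid P S ->
  0 < C -> 0 < omega -> (forall i, JL P (S i.+1) C omega) ->
  0 < delta < 1 ->
  ln 2 / C * Num.max (omega ^+ 2) (delta ^+ 2)^-1 < p%:R ->
  (1 <= lam)%N -> (lam <= k.+1)%N ->
  forall t : R, `|t| <= omega^-1 ->
  let SS := fun x i => S i x in
  let X := fun x => expR (t * (rhot A b B x0 (SS x) lam k - rho A b B x0 (SS x) lam k)) in
  let Mx := fun x => Mconst A b B x0 Bh (SS x) (k.+1 - lam) in
  let bnd1 := fun x => t ^+ 2 * Mx x ^+ 4 / (2 * C * p%:R * lam%:R)
                       * \sum_(1 <= j < lam.+1) (j%:R)^-1 in
  let bnd2 := fun x => t ^+ 2 * (Mx x ^+ 4 * (1 + ln lam%:R) / (2 * C * p%:R * lam%:R)) in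
  (forall Y, is_cond_exp P (filt S (k.+1 - lam)) X Y ->
     {ae P, forall x, (Y x <= (expR (bnd1 x))%:E)%E}) /\
  (forall x, expR (bnd1 x) <= expR (bnd2 x)).
Proof.
have sq4 (r : R) : 0 <= r ^+ 4 by exact: exprn_even_ge0.
move=> _ [BhT _] BhB iidS C0 w0 JLS _ hp lam1 lamk t tw SS X Mx bnd1 bnd2.
have lam0 : 0 < lam%:R :> R by rewrite ltr0n.
(* The lower bound imposed on [p] is nonnegative, so [p] is positive and the denominators are
   nonzero. *)
have p0 : 0 < p%:R :> R.
  apply: le_lt_trans hp; rewrite mulr_ge0//.
    by rewrite divr_ge0 ?(ltW C0)// ln_ge0// ler1n.
  by rewrite le_max sqr_ge0.
have K0 x : 0 <= t ^+ 2 * Mx x ^+ 4 / (2 * C * p%:R * lam%:R).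
  apply: divr_ge0; first exact: (mulr_ge0 (sqr_ge0 t) (sq4 _)).
  by rewrite ltW ?mulr_gt0.
split; last first.
  move=> x; rewrite ler_expR /bnd1 /bnd2; move: (Mx x) (K0 x) => M K.
  rewrite (mulrA (t ^+ 2) (M ^+ 4 * _)) (mulrA (t ^+ 2) (M ^+ 4)) [leRHS]mulrAC.
  by apply: ler_wpM2l; last exact: harmonic_le.
move=> Y [GY Y0 EY]; set j := (k.+1 - lam)%N in GY EY *.
(* The averaging factor of the estimators is moved into the parameter, which stays in the admissible
   range because [lam] is at least 1. *)
pose s := t / lam%:R.
have s_le : `|s| <= omega^-1.
  rewrite normrM normfV (ger0_norm (ltW lam0)) (le_trans _ tw)//.
  by rewrite ler_piMr// invf_le1// ler1n.
pose c x := s ^+ 2 * Mx x ^+ 4 / (2 * C * p%:R).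
have cE x : lam%:R * c x = t ^+ 2 * Mx x ^+ 4 / (2 * C * p%:R * lam%:R).
  by rewrite /c /s; field; rewrite !gt_eqF.
(* The term of index 1 in the harmonic sum already accounts for [lam%:R * c x]. *)
have c_le x : lam%:R * c x <= bnd1 x.
  rewrite cE /bnd1 ler_peMr// big_ltn// invr1 lerDl sumr_ge0//.
have XE x : X x = expR (lam%:R * c x) * expR (\sum_(j <= i < j + lam)
    s * (norm2 (sgrad A b B x0 (SS x) i) ^+ 2
         - norm2 (grad A b B x0 (SS x) i) ^+ 2) - lam%:R * c x).
  rewrite -expRD subrKC /X /rhot /rho -/j /j subnK//; congr expR.
  by rewrite -mulr_sumr sumrB -mulrBr /s mulrA.
have Gm := @filt_gen_measurable _ _ _ _ _ _ _ iidS j.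
have mS q : (1 <= q <= j)%N ->
    mx_measurable (S q : g_sigma_algebraType (filt_gen S j) -> _).
  exact: mx_measurable_filt.
have mM : measurable_fun setT (fun x : g_sigma_algebraType (filt_gen S j) => Mx x ^+ 4).
  under eq_fun do rewrite (exprM _ 2 2).
  apply: measurable_funX; exact: (measurable_sqr_Mconst A b x0 BhT BhB mS).
have mexp (a e : R) : measurable_fun setT
    (fun x : g_sigma_algebraType (filt_gen S j) => expR (a * Mx x ^+ 4 * e)).
  apply: measurableT_comp => //.
  by apply: measurable_funM => //; exact: measurable_funM.
have mbnd1 : measurable_fun setT
    (fun x : g_sigma_algebraType (filt_gen S j) => expR (bnd1 x)).
  rewrite /bnd1; under eq_fun do rewrite -(mulrA _ (_^-1)).
  exact: mexp.
have mc : measurable_fun setT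
    (fun x : g_sigma_algebraType (filt_gen S j) => expR (lam%:R * c x)).
  by under eq_fun do rewrite cE; exact: mexp.
(* It remains to compare integrals over events [E] of the conditioning sigma-algebra, where [Y] may
   be replaced by [X]. *)
apply: (ae_le_of_integral_le (G := filt_gen S j) (g := fun x => expR (bnd1 x))) => //.
- by move=> _ U mU; rewrite setTI; exact: GY.
move=> E GE; rewrite (EY _ GE).
have mE : measurable E by exact: Gm.
(* The weight restricts to [E] and restores the factor [expR (lam%:R * c x)] that the window bound
   compensates. *)
pose U (x : T) := \1_E x * expR (lam%:R * c x).
have mU : measurable_fun setT (U : g_sigma_algebraType (filt_gen S j) -> R).
  by apply: measurable_funM => //; exact: measurable_indic.
have U0 x : 0 <= U x by rewrite mulr_ge0 ?expR_ge0.
have := window_exp_le A b x0 BhT BhB iidS C0 JLS s_le lam U0 mU.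
have -> : (\int[P]_x (U x * expR (\sum_(j <= i < j + lam)
    s * (norm2 (sgrad A b B x0 (S^~ x) i) ^+ 2
         - norm2 (grad A b B x0 (S^~ x) i) ^+ 2)
    - lam%:R * (s ^+ 2 * Mconst A b B x0 Bh (S^~ x) j ^+ 4 / (2 * C * p%:R))))%:E
    = \int[P]_(x in E) (X x)%:E)%E.
  rewrite [RHS]integral_mkcond; apply: eq_integral => x _.
  rewrite /U -mulrA -XE patchE indicE.
  by case: ifPn => _; rewrite ?mul1r ?mul0r.
have -> : (\int[P]_x (U x)%:E = \int[P]_(x in E) (expR (lam%:R * c x))%:E)%E.
  rewrite [RHS]integral_mkcond; apply: eq_integral => x _.
  by rewrite /U patchE indicE; case: ifPn => _; rewrite ?mul1r ?mul0r.
move=> /le_trans; apply; apply: ge0_le_integral => //.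
- apply/measurable_EFinP/measurable_funTS.
  exact: measurable_fun_sub mc.
- apply/measurable_EFinP/measurable_funTS.
  exact: measurable_fun_sub mbnd1.
- by move=> x _; rewrite lee_fin ler_expR.
Qed.
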